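(* Let $M=(X,d)$ be a metric space with $\eta(M)>0$, and let $M'$ be a metric space. The lexicographic metric space $M\circ M'$ is totally bounded if and only if $X$ is finite and $M'$ is totally bounded.
   Context: All metric spaces are nonempty. For a metric space $M=(X,d)$ and $x\in X$, the nearness of $x$ is $\eta(x)=\inf\{d(x,y): y\in X\setminus\{x\}\}$ and the nearness of $M$ is $\eta(M)=\inf\{\eta(x): x\in X\}$ (with $\inf\emptyset=+\infty$). If $M=(X,d)$ and $M'=(Y,d_Y)$ are metric spaces with $\eta(M)>0$, the lexicographic metric space is $M\circ M'=(X\times Y,\rho)$, where $\rho((x,y),(x',y'))=d(x,x')$ if $x\neq x'$, and $\rho((x,y),(x',y'))=\min\{2\eta(x),d_Y(y,y')\}$ if $x=x'$; $\rho$ is a metric. A metric space is totally bounded if for every $\epsilon>0$ it is covered by finitely many open balls of radius $\epsilon$. *)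

(* Defs.v *)
From HB Require Import structures.
From mathcomp Require Import all_boot all_order all_algebra.
From mathcomp Require Import all_classical all_reals all_analysis.

Set Implicit Arguments.
Unset Strict Implicit.
Unset Printing Implicit Defensive.

Import Order.TTheory GRing.Theory Num.Theory.

Local Open Scope classical_set_scope.
Local Open Scope ring_scope.
Local Open Scope ereal_scope.

(* +oo when x is the only point of the space, since ereal_inf set0 = +oo *)
Definition point_nearness (R : realType) (M : metricType R) (x : M) : \bar R :=
  ereal_inf [set (mdist x y)%:E | y in ~` [set x]].

Definition nearness (R : realType) (M : metricType R) : \bar R :=
  ereal_inf [set point_nearness x | x in [set: M]].

(* The minimum is a finite nonnegative number even when point_nearness p.1 is
   +oo, so fine loses no information (lexdist_fin below). *)
Definition lexdist (R : realType) (M M' : metricType R) (p q : M * M') : R :=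
  if p.1 == q.1 then
    fine (mine (2%:E * point_nearness p.1) (mdist p.2 q.2)%:E)
  else mdist p.1 q.1.

(* An alias of the product type, because M * M' already carries the
   (pseudo)metric structure of the max distance. *)
Definition lexicographic (R : realType) (M M' : metricType R)
  (etaM : 0 < nearness M) : Type := (M * M')%type.

(* ball x e is the open ball [set y | mdist x y < e], see ballEmdist *)
Definition totally_bounded (R : realType) (M : metricType R) : Prop :=
  forall e : R, (0 < e)%R ->
    exists2 A : set M, finite_set A & [set: M] `<=` \bigcup_(x in A) ball x e.

Section lexicographic_metric.
Context (R : realType) (M M' : metricType R).

Lemma point_nearness_ge0 (x : M) : 0 <= point_nearness x.
Proof. by apply: le_ereal_inf_tmp => _ [y _ <-]; rewrite lee_fin mdist_ge0. Qed.

Lemma point_nearness_le (x y : M) : x != y ->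
  point_nearness x <= (mdist x y)%:E.
Proof.
move=> xy; apply: ereal_inf_lbound; exists y => //= yx.
by move: xy; rewrite yx eqxx.
Qed.

Lemma lexdist_fin (x : M) (y y' : M') :
  (lexdist (x, y) (x, y'))%:E =
  mine (2%:E * point_nearness x) (mdist y y')%:E.
Proof.
rewrite /lexdist /= eqxx fineK// ge0_fin_numE.
  by rewrite (le_lt_trans _ (ltry (mdist y y')))// ge_min lexx orbT.
by rewrite le_min mule_ge0 ?point_nearness_ge0 ?lee_fin ?mdist_ge0.
Qed.

Lemma lexdist_neq (p q : M * M') : p.1 != q.1 -> lexdist p q = mdist p.1 q.1.
Proof. by rewrite /lexdist => /negPf ->. Qed.

Lemma lexdist_ge0 (p q : M * M') : (0 <= lexdist p q)%R.
Proof.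
case: p q => [x y] [x' y']; have [<-|xx'] := eqVneq x x'.
  rewrite -lee_fin lexdist_fin le_min mule_ge0 ?point_nearness_ge0 ?lee_fin//.
  exact: mdist_ge0.
by rewrite lexdist_neq//= mdist_ge0.
Qed.

Lemma lexdistxx (p : M * M') : lexdist p p = 0%R.
Proof.
case: p => x y; apply/eqP; rewrite -eqe lexdist_fin mdistxx min_r//.
by rewrite mule_ge0 ?point_nearness_ge0.
Qed.

Lemma lexdist_sym (p q : M * M') : lexdist p q = lexdist q p.
Proof.
case: p q => [x y] [x' y']; have [<-|xx'] := eqVneq x x'.
  by apply/eqP; rewrite -eqe !lexdist_fin metric_sym.
by rewrite !lexdist_neq//= 1?eq_sym//; exact: metric_sym.
Qed.

Lemma lexdist_triangle (q p r : M * M') :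
  (lexdist p r <= lexdist p q + lexdist q r)%R.
Proof.
case: p q r => [x a] [y b] [z c].
have [<-{y}|xy] := eqVneq x y.
  have [<-{z}|xz] := eqVneq x z; last first.
    by rewrite (lexdist_neq (p:=(x, a)) (q:=(z, c)))//
      (lexdist_neq (p:=(x, b)) (q:=(z, c)))//= lerDr lexdist_ge0.
  have ab := lexdist_fin x a b; have bc := lexdist_fin x b c.
  rewrite -lee_fin EFinD lexdist_fin ge_min.
  have := lexdist_ge0 (x, a) (x, b); have := lexdist_ge0 (x, b) (x, c).
  rewrite -!(lee_fin 0) => bc0 ab0.
  move: ab bc; rewrite /mine; case: ifPn => _ ab; last case: ifPn => _ bc.
  - by rewrite -ab leeDl.
  - by rewrite -bc leeDr.
  - by rewrite ab bc -EFinD lee_fin metric_triangle orbT.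
have [xz|xz] := eqVneq x z.
  subst z; rewrite (lexdist_neq (p:=(x, a)) (q:=(y, b)))//.
  rewrite (lexdist_neq (p:=(y, b)) (q:=(x, c)))/= 1?eq_sym//.
  rewrite -lee_fin lexdist_fin ge_min (metric_sym y x).
  have -> : (mdist x y + mdist x y)%:E = 2%:E * (mdist x y)%:E.
    by rewrite -EFinM mulr_natl mulr2n.
  by rewrite lee_wpmul2l ?lee_fin// point_nearness_le.
rewrite (lexdist_neq (p:=(x, a)) (q:=(z, c)))//.
rewrite (lexdist_neq (p:=(x, a)) (q:=(y, b)))//=.
have [<-|yz] := eqVneq y z; first by rewrite lerDl lexdist_ge0.
by rewrite (lexdist_neq (p:=(y, b)) (q:=(z, c)))//= metric_triangle.
Qed.

Hypothesis etaM : 0 < nearness M.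

Lemma point_nearness_gt0 (x : M) : 0 < point_nearness x.
Proof. by apply: lt_le_trans etaM _; apply: ereal_inf_lbound; exists x. Qed.

Lemma lexdist_positivity (p q : M * M') : lexdist p q = 0%R -> p = q.
Proof.
case: p q => [x y] [x' y']; have [<-|xx'] := eqVneq x x'; last first.
  by rewrite lexdist_neq//= => /mdist_positivity xx; rewrite xx eqxx in xx'.
move=> yy'0; have := lexdist_fin x y y'; rewrite yy'0 /mine; case: ifPn => _.
  move=> /esym/eqP; rewrite mule_eq0 eqe pnatr_eq0/= => /eqP x0.
  by have := point_nearness_gt0 x; rewrite x0 ltxx.
by move=> [/esym/mdist_positivity ->].
Qed.

HB.instance Definition _ := Choice.on (lexicographic M' etaM).

HB.instance Definition _ :=
  @isMetric.Build R (lexicographic M' etaM) (@lexdist R M M')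
    lexdistxx lexdist_positivity lexdist_sym lexdist_triangle.

Lemma lexicographic_mdistE (p q : lexicographic M' etaM) :
  mdist p q = lexdist p q.
Proof. by []. Qed.

Lemma lexicographic_ballE (p : lexicographic M' etaM) (e : R) :
  ball p e = [set q | (lexdist p q < e)%R].
Proof. exact: ballEmdist. Qed.

End lexicographic_metric.

Arguments lexicographic {R} M M' etaM.

(* Main.v *)
Require Import Defs.
From mathcomp Require Import all_boot all_order all_algebra.
From mathcomp Require Import all_classical all_reals all_analysis.

(** At scales below the nearness of [M], the lexicographic space is a disjoint
    union of isometric copies of [M']: two points whose distance is less than
    [nearness M] lie over the same point of [M], and the truncation by
    [2 * point_nearness x] is inactive on them
    ([lexdist_lt_nearness]).  Hence the balls of a cover at such a small scale
    each stay inside a single fibre.  Projecting their centres to [M] reaches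
    every point of [M], as no fibre is empty, so [M] is finite; projecting them to [M'] gives
    a net of [M'], because those lying over one fixed point of [M] already cover
    that copy of [M'].

    Conversely the distance inside a fibre is at most that of [M']
    ([lexdist_fiber_le]), so the product of a finite [M] with a finite net of
    [M'] is a finite net at the same scale. *)

Import Order.TTheory GRing.Theory Num.Theory.

Local Open Scope classical_set_scope.
Local Open Scope ring_scope.

Lemma lexdist_fiber_le (R : realType) (M M' : metricType R) (x : M)
  (y y' : M') : lexdist (x, y) (x, y') <= mdist y y'.
Proof. by rewrite -lee_fin lexdist_fin ge_min lexx orbT. Qed.

(** Over different points the distance is a distance of [M], hence at least
    [nearness M]; over the same point a value below [nearness M] cannot come
    from the term [2 * point_nearness x] of the minimum. *)
Lemma lexdist_lt_nearness (R : realType) (M M' : metricType R)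
  (p q : M * M') : ((lexdist p q)%:E < nearness M)%E ->
  p.1 = q.1 /\ mdist p.2 q.2 = lexdist p q.
Proof.
have near_le (x : M) : (nearness M <= point_nearness x)%E.
  by apply: ereal_inf_lbound; exists x.
case: p q => [x y] [x' y']; have [<-{x'}|xx'] := eqVneq x x'; last first.
  rewrite lexdist_neq//= => /lt_le_trans/(_ (near_le x)).
  by move=> /lt_le_trans/(_ (point_nearness_le xx')); rewrite ltxx.
rewrite lexdist_fin => small; split=> //=.
suff : (mdist y y')%:E = (lexdist (x, y) (x, y'))%:E by case.
rewrite lexdist_fin; move: small; rewrite /mine; case: ifPn => // _.
move=> /lt_le_trans/(_ (near_le x)) /=.
rewrite ltNge => /negP; case.
by rewrite lee_pemull ?point_nearness_ge0// lee_fin ler1n.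
Qed.

(** Nearness may be [+oo], so a usable scale is a real number below it. *)
Lemma small_radius (R : realType) (eta : \bar R) (e : R) :
  (0 < eta)%E -> 0 < e -> exists r : R, [/\ 0 < r, r <= e & (r%:E <= eta)%E].
Proof.
case: eta => [t| |] // t0 e0; last by exists e; split=> //; exact: leey.
exists (Num.min e t); split; last by rewrite lee_fin ge_min lexx orbT.
  by rewrite lt_min e0 -lte_fin.
by rewrite ge_min lexx.
Qed.

Theorem theorem7 (R : realType) (M M' : metricType R)
  (M_nonempty : [set: M] !=set0) (M'_nonempty : [set: M'] !=set0)
  (etaM : (0 < nearness M)%E) :
  totally_bounded (lexicographic M M' etaM) <->
  finite_set [set: M] /\ totally_bounded M'.
Proof.
split=> [tb|[finM tb] e e0]; last first.
  have [A finA covA] := tb e e0.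
  exists ([set: M] `*` A : set (lexicographic M M' etaM)).
    exact: finite_setX.
  move=> [x y] _; have [a Aa] := covA y I; rewrite ballEmdist => ay.
  exists (x, a) => //; rewrite lexicographic_ballE /=.
  exact: le_lt_trans (lexdist_fiber_le _ _ _ _ _ _) ay.
(* Radii are shrunk below the nearness of M, so that the centre covering (x, y)
   must lie over x itself. *)
have fiber_net e : 0 < e -> exists2 A : set (M * M'), finite_set A &
    forall x y, exists a, [/\ A a, a.1 = x & mdist a.2 y < e].
  move=> e0; have [r [r0 re rM]] := small_radius _ _ _ etaM e0.
  have [A finA covA] := tb r r0; exists A => // x y.
  have [a Aa] := covA (x, y) I; rewrite lexicographic_ballE /= => axy.
  have [|ax ay] := @lexdist_lt_nearness R M M' a (x, y).
    by apply: lt_le_trans rM; rewrite lte_fin.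
  exists a; split=> //; rewrite -[y]/((x, y).2) ay.
  exact: lt_le_trans axy re.
split.
  have [y0 _] := M'_nonempty.
  (* Any radius serves here: only the first components of the net matter. *)
  have [A finA covA] := fiber_net 1 ltr01.
  apply: sub_finite_set (finite_image fst finA) => x _.
  by have [a [Aa ax _]] := covA x y0; exists a.
move=> e e0; have [x0 _] := M_nonempty.
have [A finA covA] := fiber_net e e0.
exists (snd @` A); first exact: finite_image.
move=> y _; have [a [Aa _ ay]] := covA x0 y.
by exists a.2; [exists a|rewrite ballEmdist].
Qed.
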